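(* For every infinite hyperbolic group $\Gamma$ and finite generating set $S \subseteq \Gamma$, there exists an isometric affine action $\alpha$ of $\Gamma$ on a Banach space $V$ isomorphic to $\ell^1$ such that the orbit map $\gamma \mapsto \alpha(\gamma)(0)$ is an isometric embedding $\Gamma \hookrightarrow V$ (with respect to the $S$-word metric on $\Gamma$). In particular, every hyperbolic group admits a proper, uniformly Lipschitz affine action on $\ell^1$.
   Context: A hyperbolic group is a finitely generated group which, with the word metric of a finite generating set, is a Gromov hyperbolic metric space: for some $\delta\ge0$, $(x|z)_p\ge\min\{(x|y)_p,(y|z)_p\}-\delta$ for all $x,y,z,p$, where $(x|y)_p=\frac12(d(x,p)+d(p,y)-d(x,y))$. The $S$-word metric is the left-invariant metric where $d(g,h)$ is the least length of a word in $S\cup S^{-1}$ representing $g^{-1}h$. An affine action of $\Gamma$ on a real Banach space $V$ is a group action by maps $\alpha(\gamma)(v)=\pi(\gamma)v+b(\gamma)$, with $\pi(\gamma)$ a bounded invertible linear operator on $V$ and $b(\gamma)\in V$. It is isometric if every $\alpha(\gamma)$ is an isometry; uniformly Lipschitz if the maps $\alpha(\gamma)$, $\gamma\in\Gamma$, are $L$-Lipschitz for a common $L<\infty$; and proper if for every $v\in V$ and $R<\infty$ the set $\{\gamma\in\Gamma:\|\alpha(\gamma)(v)\|\le R\}$ is finite. Isomorphic means linearly isomorphic as Banach spaces; $\ell^1=\ell^1(\mathbb{N})$. *)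

(* Defs.v *)
From HB Require Import structures.
From mathcomp Require Import all_boot all_order all_algebra.
From mathcomp Require Import all_classical all_reals all_analysis.

Set Implicit Arguments.
Unset Strict Implicit.
Unset Printing Implicit Defensive.

Import Order.TTheory GRing.Theory Num.Theory.
Import numFieldNormedType.Exports.

Local Open Scope classical_set_scope.
Local Open Scope ring_scope.

Section Ell1.
Variable R : realType.

Definition summable_seq : {pred nat -> R} :=
  fun u => `[< cvgn (series (fun n => `|u n|)) >].

Lemma summableP (u : nat -> R) :
  u \in summable_seq <-> exists M, forall N, series (fun n => `|u n|) N <= M.
Proof.
have nd : nondecreasing_seq (series (fun n => `|u n|)).
  by apply/nondecreasing_seqP => n; rewrite seriesSr lerDl.
rewrite unfold_in; split=> [/asboolP cu|[M uM]].
  by exists (limn (series (fun n => `|u n|))) => N;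
    exact: nondecreasing_cvgn_le.
apply/asboolP; apply: nondecreasing_is_cvgn => //.
by exists M => _ [N _ <-].
Qed.

Lemma summable_submod_closed : submod_closed summable_seq.
Proof.
split=> [|a u v /summableP[M uM] /summableP[M' vM']]; apply/summableP.
  by exists 0 => N; rewrite /series /= big1// => i _; rewrite normr0.
exists (`|a| * M + M') => N.
apply: le_trans (lerD (ler_wpM2l (normr_ge0 a) (uM N)) (vM' N)).
rewrite /series /= mulr_sumr -big_split /=; apply: ler_sum => i _.
by rewrite -normrM; exact: ler_normD.
Qed.

HB.instance Definition _ :=
  GRing.isSubmodClosed.Build R (nat -> R) summable_seq summable_submod_closed.

Record ell1 : Type :=
  Ell1 { ell1_val :> nat -> R; ell1_summable : ell1_val \in summable_seq }.

HB.instance Definition _ := [isSub for ell1_val].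
HB.instance Definition _ := [Choice of ell1 by <:].
HB.instance Definition _ := [SubChoice_isSubLmodule of ell1 by <:].

Definition ell1_norm (u : ell1) : R := limn (series (fun n => `|u n|)).

Lemma ell1_norm_ub (u : ell1) N : series (fun n => `|u n|) N <= ell1_norm u.
Proof.
apply: nondecreasing_cvgn_le; first by apply/nondecreasing_seqP => n;
  rewrite seriesSr lerDl.
by have := ell1_summable u; rewrite unfold_in => /asboolP.
Qed.

Lemma ell1_norm_le (u : ell1) M :
  (forall N, series (fun n => `|u n|) N <= M) -> ell1_norm u <= M.
Proof.
move=> uM; apply: limr_le; last exact: nearW.
by have := ell1_summable u; rewrite unfold_in => /asboolP.
Qed.

Lemma ell1_normD (u v : ell1) : ell1_norm (u + v) <= ell1_norm u + ell1_norm v.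
Proof.
apply: ell1_norm_le => N.
apply: le_trans (lerD (ell1_norm_ub u N) (ell1_norm_ub v N)).
rewrite /series /= -big_split /=; apply: ler_sum => i _; exact: ler_normD.
Qed.

Lemma ell1_normZ (a : R) (u : ell1) : ell1_norm (a *: u) = `|a| * ell1_norm u.
Proof.
have le b (w : ell1) : ell1_norm (b *: w) <= `|b| * ell1_norm w.
  apply: ell1_norm_le => N.
  apply: le_trans (ler_wpM2l (normr_ge0 b) (ell1_norm_ub w N)).
  rewrite /series /= mulr_sumr; apply: ler_sum => i _.
  by rewrite -normrM.
apply/eqP; rewrite eq_le le /=.
have [->|a0] := eqVneq a 0.
  by rewrite normr0 mul0r (le_trans _ (ell1_norm_ub _ 0%N))// /series /= big_geq.
rewrite -[in leLHS](scale1r u) -(mulVf a0) -scalerA.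
apply: le_trans (ler_wpM2l (normr_ge0 a) (le _ _)) _.
by rewrite mulrA -normrM divff// normr1 mul1r.
Qed.

Lemma ell1_coord_le (u : ell1) n : `|u n| <= ell1_norm u.
Proof.
apply: le_trans (ell1_norm_ub u n.+1).
by rewrite seriesSr lerDr /series /=; apply: sumr_ge0.
Qed.

Lemma ell1_norm_eq0 (u : ell1) : ell1_norm u = 0 -> u = 0.
Proof.
move=> u0; apply: val_inj; apply/funext => n; apply/eqP.
by rewrite -normr_le0 -u0; exact: ell1_coord_le.
Qed.

HB.instance Definition _ :=
  @Lmodule_isNormed.Build R ell1 ell1_norm ell1_normD ell1_normZ ell1_norm_eq0.

Lemma ell1_normE (u : ell1) : `|u| = limn (series (fun n => `|u n|)).
Proof. by []. Qed.

Lemma ell1_complete (F : set_system ell1) :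
  ProperFilter F -> cauchy F -> cvg F.
Proof.
move=> FF /cauchy_ballP Fc.
have coord n : cvg ((fun u : ell1 => u n) @ F).
  apply: cauchy_cvg; apply/cauchy_ballP => e e0; near_simpl.
  apply: filterS (Fc e e0) => -[u v]; rewrite -!ball_normE /=.
  exact/le_lt_trans/(ell1_coord_le (u - v)).
pose l n : R := lim ((fun u : ell1 => u n) @ F).
have key e : 0 < e ->
    F (fun u : ell1 => forall N, series (fun n => `|u n - l n|) N <= e).
  move=> e0; apply: filterS (nearP_dep (Fc e e0)) => u Fu N.
  have cvS : (fun v : ell1 => series (fun n => `|u n - v n|) N) v @[v --> F]
      --> series (fun n => `|u n - l n|) N.
    elim: N => [|N IH].
      have s0 (w : nat -> R) : series w 0%N = 0 by rewrite /series /= big_geq.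
      by rewrite s0; under eq_fun do rewrite s0; exact: cvg_cst.
    rewrite seriesSr; under eq_fun do rewrite seriesSr.
    apply: (cvgD IH); apply: cvg_norm.
    by apply: cvgB; [exact: cvg_cst|exact: coord].
  apply: (cvgr_to_le cvS); apply: filterS Fu => v.
  rewrite -ball_normE /= => /ltW; apply: le_trans.
  exact: (ell1_norm_ub (u - v)).
have [u0 u0P] : exists u : ell1, forall N, series (fun n => `|u n - l n|) N <= 1.
  exact: (@filter_ex _ F _ _ (key 1 ltr01)).
have lS : l \in summable_seq.
  have -> : l = ell1_val u0 - (fun n => u0 n - l n).
    by apply/funext => n; rewrite !fctE subKr.
  by apply: rpredB; [exact: ell1_summable|apply/summableP; exists 1].
apply/cvg_ex; exists (Ell1 lS); apply/cvgrPdist_le => e e0.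
apply: filterS (key e e0) => u ule; rewrite distrC.
exact: (@ell1_norm_le (u - Ell1 lS)).
Qed.

HB.instance Definition _ := Uniform_isComplete.Build ell1 ell1_complete.

End Ell1.

Section WordMetric.
Variable G : groupType.
Implicit Types (S : set G) (x g h : G).

Definition words S x : set (seq G) :=
  [set w | (forall s, s \in w -> S s \/ S s^-1%g) /\
           \big[*%g/1%g]_(s <- w) s = x].

Definition generates S := forall x, words S x !=set0.

(* The junk value 0 is taken only when no word in S and its inverses
   represents x. *)
Definition word_length S x : nat :=
  xget 0%N [set n | (exists2 w, words S x w & size w = n) /\
                    forall w, words S x w -> (n <= size w)%N].

Lemma word_lengthP S x : generates S ->
  (exists2 w, words S x w & size w = word_length S x) /\
  forall w, words S x w -> (word_length S x <= size w)%N.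
Proof.
move=> /(_ x)[w0 w0x]; rewrite /word_length; case: xgetP => [n _ //|no].
have ex : exists n, `[< exists2 w, words S x w & size w = n >].
  by exists (size w0); apply/asboolP; exists w0.
case: (ex_minnP ex) => n /asboolP nw nmin; case: (no n); split=> // w wx.
by apply: nmin; apply/asboolP; exists w.
Qed.

Definition word_dist S g h : nat := word_length S (g^-1 * h)%g.

End WordMetric.

Section Hyperbolic.
Variable R : realType.

Definition gromov_product (T : Type) (d : T -> T -> R) (p x y : T) : R :=
  (d x p + d p y - d x y) / 2.

Definition gromov_hyperbolic (T : Type) (d : T -> T -> R) : Prop :=
  exists2 delta : R, 0 <= delta &
    forall x y z p, Num.min (gromov_product d p x y) (gromov_product d p y z)
                      - delta <= gromov_product d p x z.

Definition hyperbolic_group (G : groupType) : Prop :=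
  exists S : set G, [/\ finite_set S, generates S &
    gromov_hyperbolic (fun g h => (word_dist S g h)%:R)].

End Hyperbolic.

Section AffineActions.
Variable R : realType.

Definition bounded_operator (V W : normedModType R) (f : V -> W) : Prop :=
  exists C : R, forall v, `|f v| <= C * `|v|.

Definition bounded_invertible (V W : normedModType R) (f : {linear V -> W}) :
    Prop :=
  bounded_operator f /\
  exists f' : {linear W -> V},
    [/\ bounded_operator f', cancel f f' & cancel f' f].

Definition isomorphic_banach (V W : completeNormedModType R) : Prop :=
  exists f : {linear V -> W}, bounded_invertible f.

Variables (G : groupType) (V : completeNormedModType R).
Implicit Type alpha : G -> V -> V.

Definition group_action alpha : Prop :=
  (forall v, alpha 1%g v = v) /\
  (forall g h v, alpha (g * h)%g v = alpha g (alpha h v)).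

Definition affine_action alpha : Prop :=
  group_action alpha /\
  exists (pi : G -> {linear V -> V}) (b : G -> V),
    forall g, bounded_invertible (pi g) /\
              forall v, alpha g v = pi g v + b g.

Definition isometric_action alpha : Prop :=
  forall g v w, `|alpha g v - alpha g w| = `|v - w|.

Definition uniformly_lipschitz alpha : Prop :=
  exists L : R, forall g, L.-lipschitz (alpha g).

Definition proper_action alpha : Prop :=
  forall (v : V) (r : R), finite_set [set g | `|alpha g v| <= r].

End AffineActions.

(* Main.v *)
Require Import Defs.
From HB Require Import structures.
From mathcomp Require Import all_boot all_order all_algebra.
From mathcomp Require Import all_classical all_reals all_analysis.
From mathcomp Require Import zify lra.

Set Implicit Arguments.
Unset Strict Implicit.
Unset Printing Implicit Defensive.

Import Order.TTheory GRing.Theory Num.Theory.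
Import numFieldNormedType.Exports.

Local Open Scope classical_set_scope.
Local Open Scope ring_scope.

(** The Banach space is the Lipschitz-free space of the group: the completion
of the finitely supported signed measures on [G] modulo the Dirac mass at [1],
normed by duality with the 1-Lipschitz functions.  Every isometry of a metric
space induces an isometric affine map of its free space, and Dirac masses embed
the metric space isometrically; so left translations give the required action
at once.  What has to be proved is that the free space is isomorphic to [l^1].

The isomorphism comes from a random walk that descends to the identity.  In a
hyperbolic group, fix a large step [N]; from [x <> 1] jump to a uniformly chosen
point of the nearest lower sphere whose radius is a multiple of [N], among the
points that lie within a bounded distance of the geodesics from [1] to [x].
Call [P] the averaging operator of this walk.  Mapping the basis vector [e_x] to
[delta_x - P delta_x] defines a bounded map from [l^1(G \ {1})] to the free
space, because jumps are bounded.  Its inverse sends [delta_x] to the Green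
measure of the walk started at [x] (a finite sum, because the walk terminates),
and is bounded as soon as the Green measures of neighbouring points are at
bounded distance in [l^1].  Dually: if [f - P f] is bounded by [1], then [f] is
Lipschitz with a fixed constant.  This holds because two walks started at
neighbouring points stay at bounded distance on every sphere they visit, and
their next jumps have a common target, since a geodesic from either point also
serves the other; so at each step the oscillation of [f] at that scale is
contracted by a fixed factor before a bounded error is added
([sphere_osc], [potential_lipschitz]).  Of hyperbolicity, only the four-point
inequality based at [1] enters.

Instead of completing a quotient, the free space is realised as [l^1] itself
with the equivalent norm transported by this isomorphism: [u] pairs with a
Lipschitz function [f] by [sum_n u_n (f - P f)(x_n)], where [x_n] enumerates
[G \ {1}], and the norm is the supremum of these pairings over 1-Lipschitz [f].
Solving [f - P f = sign u] shows that it dominates a multiple of the [l^1] norm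
([pairing_attained]).  All identities about the action, such as the action law,
are then checked against Lipschitz functions, where the action becomes the
composition of [f] with a translation ([pairing_push]).

Hyperbolicity is given for one generating set and the norm is needed for
another; word metrics of finite generating sets are bi-Lipschitz equivalent and
the properties asked of the walk only change their constants, so no invariance
of hyperbolicity is involved.  The second assertion transports the action along
the isomorphism with [l^1]; it is proper because balls are finite. *)

(** * Equivalent norms on a Banach space *)

Definition linear_map (R : pzRingType) (U W : lmodType R) (f : U -> W)
    (lf : linear f) : {linear U -> W} :=
  HB.pack f (GRing.isLinear.Build _ _ _ _ f lf).

Section Renorming.
Variables (R : realType) (V : completeNormedModType R).

Record equivalent_norm := EquivalentNorm {
  eqnorm :> V -> R ;
  eqnormD : forall u v, eqnorm (u + v) <= eqnorm u + eqnorm v ;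
  eqnormZ : forall a u, eqnorm (a *: u) = `|a| * eqnorm u ;
  eqnorm_bound : exists2 K : R, 0 < K & forall u, eqnorm u <= K * `|u| ;
  eqnorm_cobound : exists2 C : R, 0 < C & forall u, `|u| <= C * eqnorm u }.

(** An alias of [V], so that the new norm does not compete with the old one. *)
Definition renormed (N : equivalent_norm) : Type := V.

Variable N : equivalent_norm.

HB.instance Definition _ := GRing.Lmodule.on (renormed N).

Lemma eqnorm_eq0 (u : renormed N) : N u = 0 -> u = 0.
Proof.
case: (eqnorm_cobound N) => C _ NC u0; apply/eqP.
by rewrite -normr_le0 (le_trans (NC u))// u0 mulr0.
Qed.

HB.instance Definition _ := @Lmodule_isNormed.Build R (renormed N) N
  (@eqnormD N) (@eqnormZ N) eqnorm_eq0.

Lemma renormedE (u : renormed N) : `|u| = N u.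
Proof. by []. Qed.

(** Equivalent norms have the same Cauchy filters and the same limits. *)
Lemma renormed_complete (F : set_system (renormed N)) :
  ProperFilter F -> cauchy F -> cvg F.
Proof.
move=> FF /cauchy_ballP Fc.
case: (eqnorm_cobound N) => C C0 NC; case: (eqnorm_bound N) => K K0 NK.
have FV : @cauchy V F.
  apply/cauchy_ballP => e e0; near_simpl.
  apply: filterS (Fc (e / C) (divr_gt0 e0 C0)) => -[u v].
  rewrite -!ball_normE /= renormedE ltr_pdivlMr// mulrC.
  exact/le_lt_trans/NC.
have /cvg_ex[l Fl] := @cauchy_cvg V F FF FV.
apply/cvg_ex; exists (l : renormed N); apply/cvgrPdist_lt => e e0.
move/cvgrPdist_lt : Fl => /(_ (e / K) (divr_gt0 e0 K0)).
apply: filterS => u; rewrite renormedE ltr_pdivlMr// mulrC.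
exact/le_lt_trans/NK.
Qed.

HB.instance Definition _ :=
  Uniform_isComplete.Build (renormed N) renormed_complete.

Lemma renormed_isomorphic : isomorphic_banach (renormed N) V.
Proof.
have id_linear : linear (id : V -> V) by [].
case: (eqnorm_cobound N) => C C0 NC; case: (eqnorm_bound N) => K K0 NK.
exists (linear_map (id_linear : linear (id : renormed N -> V))).
split; first by exists C.
exists (linear_map (id_linear : linear (id : V -> renormed N))).
by split; [exists K| |].
Qed.

End Renorming.

(** * Word metrics *)

Section WordLength.
Variables (G : groupType) (S : set G).
Hypothesis genS : generates S.
Implicit Types (x y : G) (w : seq G).

Definition letters : set G := [set s | S s \/ S s^-1%g].

Lemma word_length_min x w : words S x w -> (word_length S x <= size w)%N.
Proof. by case: (word_lengthP x genS) => _; exact. Qed.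

Lemma word_length_word x :
  exists2 w, words S x w & size w = word_length S x.
Proof. by case: (word_lengthP x genS). Qed.

Lemma words_cat x y w w' : words S x w -> words S y w' ->
  words S (x * y)%g (w ++ w').
Proof.
move=> [wS <-] [w'S <-]; split; last by rewrite big_cat.
by move=> s; rewrite mem_cat => /orP[]; [exact: wS|exact: w'S].
Qed.

Lemma words1 : words S 1%g [::].
Proof. by split => //; rewrite big_nil. Qed.

Lemma words_letter s : letters s -> words S s [:: s].
Proof.
by move=> Ss; split; [move=> t; rewrite inE => /eqP ->|rewrite big_seq1].
Qed.

Lemma wordsV x w :
  words S x w -> words S x^-1%g (rev (map (fun s => s^-1%g) w)).
Proof.
elim: w x => [|s w IH] x.
  by case=> _; rewrite big_nil => <-; rewrite invg1; exact: words1.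
move=> [wS]; rewrite big_cons => <-; rewrite invgM /= rev_cons -cats1.
apply: words_cat.
  by apply: IH; split => // t tw; apply: wS; rewrite inE tw orbT.
apply: words_letter; rewrite /letters /= invgK.
have := wS s (mem_head _ _); tauto.
Qed.

Lemma word_length1 : word_length S 1%g = 0%N.
Proof. by apply/eqP; rewrite -leqn0; exact: (word_length_min words1). Qed.

Lemma word_length_eq0 x : word_length S x = 0%N -> x = 1%g.
Proof.
case: (word_length_word x) => w [_ wx] <- /size0nil w0.
by rewrite -wx w0 big_nil.
Qed.

Lemma word_lengthM x y :
  (word_length S (x * y)%g <= word_length S x + word_length S y)%N.
Proof.
case: (word_length_word x) => w wx <-; case: (word_length_word y) => w' wy <-.
by rewrite -size_cat; apply: word_length_min; exact: words_cat.
Qed.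

Lemma word_lengthV x : word_length S x^-1%g = word_length S x.
Proof.
have le y : (word_length S y^-1%g <= word_length S y)%N.
  case: (word_length_word y) => w /wordsV/word_length_min.
  by rewrite size_rev size_map => + <-.
by apply/eqP; rewrite eqn_leq le -{1}(invgK x) le.
Qed.

Lemma word_length_letter s : letters s -> (word_length S s <= 1)%N.
Proof. by move/words_letter/word_length_min. Qed.

Lemma word_dist_mull g x y : word_dist S (g * x)%g (g * y)%g = word_dist S x y.
Proof. by rewrite /word_dist invgM -mulgA mulKg. Qed.

Lemma word_distC x y : word_dist S x y = word_dist S y x.
Proof. by rewrite /word_dist -word_lengthV invgM invgK. Qed.

Lemma word_dist1 x : word_dist S x 1%g = word_length S x.
Proof. by rewrite /word_dist mulg1 word_lengthV. Qed.

Lemma word_dist1l x : word_dist S 1%g x = word_length S x.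
Proof. by rewrite word_distC word_dist1. Qed.

Lemma word_distxx x : word_dist S x x = 0%N.
Proof. by rewrite /word_dist mulVg word_length1. Qed.

Lemma word_dist_triangle x y z :
  (word_dist S x z <= word_dist S x y + word_dist S y z)%N.
Proof.
rewrite /word_dist; apply: leq_trans (word_lengthM _ _).
by rewrite mulgA mulgK.
Qed.

(** The prefix of length [m] of a shortest word is a shortest word. *)
Lemma word_geodesic x m : (m <= word_length S x)%N ->
  exists y, word_length S y = m /\ (word_dist S y x + m)%N = word_length S x.
Proof.
case: (word_length_word x) => w [wS wx] sw; rewrite -sw => mw.
pose y := \big[*%g/1%g]_(s <- take m w) s.
pose z := \big[*%g/1%g]_(s <- drop m w) s.
have xE : x = (y * z)%g by rewrite -wx -[in LHS](cat_take_drop m w) big_cat.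
have ly : (word_length S y <= m)%N.
  rewrite -(size_takel mw); apply: word_length_min; split => // s /mem_take.
  exact: wS.
have lz : (word_length S z <= size w - m)%N.
  rewrite -size_drop; apply: word_length_min; split => // s /mem_drop.
  exact: wS.
have := word_lengthM y z; rewrite -xE -sw => xyz.
exists y; rewrite /word_dist [in (y^-1 * x)%g]xE mulKg; lia.
Qed.

Lemma word_length_ball (n : nat) : finite_set S ->
  exists b : seq G, forall x, (word_length S x <= n)%N -> x \in b.
Proof.
move=> /finite_seqP[l Sl]; pose l2 := l ++ map (fun s => s^-1%g) l.
have lettersl s : letters s -> s \in l2.
  rewrite /letters /= Sl /= mem_cat => -[->//|sl]; apply/orP; right.
  by rewrite -(invgK s); exact: map_f.
elim: n => [|n [b bP]].
  exists [:: 1%g] => x; rewrite leqn0 => /eqP/word_length_eq0 ->.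
  by rewrite mem_head.
exists (1%g :: [seq (s * y)%g | s <- l2, y <- b]) => x xn.
case: (word_length_word x) => -[|s w] [wS wx] sw.
  by rewrite -wx big_nil mem_head.
rewrite inE -wx big_cons; apply/orP; right; apply: allpairs_f.
  exact: (lettersl _ (wS _ (mem_head _ _))).
apply/bP/(leq_trans (@word_length_min _ w _)).
  by split => // t tw; apply: wS; rewrite inE tw orbT.
by move: xn; rewrite -sw.
Qed.

(** Sum the increments along the edges of a shortest word. *)
Lemma lipschitz_edges (R : realType) (f : G -> R) (C : R) :
  (forall x s, letters s -> `|f (x * s)%g - f x| <= C) ->
  forall x y, `|f x - f y| <= C * (word_dist S x y)%:R.
Proof.
move=> fC x y; rewrite distrC /word_dist.
case: (word_length_word (x^-1 * y)%g) => w [wS wE] <-.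
have -> : y = (x * \big[*%g/1%g]_(s <- w) s)%g by rewrite wE mulVKg.
elim: w x wS {wE y} => [|s w IH] x wS.
  by rewrite big_nil mulg1 subrr normr0 mulr0.
rewrite big_cons mulgA -[X in `|X|](subrKA (f (x * s)%g)).
rewrite (le_trans (ler_normD _ _))// -natr1 mulrDr mulr1 lerD//.
  by apply: IH => t tw; apply: wS; rewrite inE tw orbT.
by apply: fC; apply: wS; rewrite mem_head.
Qed.

End WordLength.

(** Write each of the finitely many letters of [T] as a word in [S]. *)
Lemma word_length_compare (G : groupType) (S T : set G) :
  generates S -> generates T -> finite_set T ->
  exists K : nat, forall x y, (word_dist S x y <= K * word_dist T x y)%N.
Proof.
move=> genS genT /finite_seqP[l Tl].
exists (\sum_(t <- l) word_length S t)%N => x y; rewrite /word_dist.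
case: (word_length_word genT (x^-1 * y)%g) => w [wT <-] <-.
elim: w wT => [|t w IH] wT; first by rewrite big_nil word_length1.
rewrite big_cons (leq_trans (word_lengthM _ _ _))// mulnS leq_add//; last first.
  by apply: IH => s sw; apply: wT; rewrite inE sw orbT.
have le s : s \in l -> (word_length S s <= \sum_(t <- l) word_length S t)%N.
  by move=> sl; rewrite (big_rem s)//= leq_addr.
have := wT t (mem_head _ _); rewrite Tl /= => -[/le//|/le].
by rewrite word_lengthV.
Qed.

(** * Operators on l^1 given by bounded columns *)

Section Ell1Comb.
Variable R : realType.

Lemma ell1_unit_summable n : (fun k => (k == n)%:R : R) \in @summable_seq R.
Proof.
apply/summableP; exists 1 => N; rewrite /series /=.
rewrite (eq_bigr (fun k => (k == n)%:R)); last by move=> k _; rewrite normr_nat.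
rewrite -natr_sum -[leRHS]/(1%:R) ler_nat.
have -> : (\sum_(0 <= k < N) (k == n) = count_mem n (index_iota 0 N))%N.
  rewrite -sum1_count [RHS]big_mkcond.
  by apply: eq_bigr => i _ /=; case: (i == n).
by rewrite count_uniq_mem ?iota_uniq// leq_b1.
Qed.

Definition ell1_unit n : ell1 R := Ell1 (ell1_unit_summable n).

(** The operator on [l^1] with prescribed columns [c]; for scalar columns ([W]
the field) it is the pairing of [l^1] with [l^infinity]. *)
Definition ell1_comb (W : completeNormedModType R) (c : nat -> W)
  (u : ell1 R) : W := limn (series (fun n => u n *: c n)).

Section Bounded.
Variables (W : completeNormedModType R) (c : nat -> W) (K : R).
Hypothesis cK : forall n, `|c n| <= K.

Let K0 : 0 <= K. Proof. exact: le_trans (cK 0%N). Qed.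

Let partial_le (u : ell1 R) N :
  series (fun n => `|u n *: c n|) N <= K * `|u|.
Proof.
apply: le_trans (ler_wpM2l K0 (ell1_norm_ub u N)).
rewrite /series /= mulr_sumr; apply: ler_sum => i _.
by rewrite normrZ mulrC ler_wpM2r.
Qed.

Lemma ell1_comb_cvg (u : ell1 R) : cvgn (series (fun n => u n *: c n)).
Proof.
apply: normed_cvg.
suff : cvgn (series (fun n => `|u n *: c n|)) by [].
apply: nondecreasing_is_cvgn.
  by apply/nondecreasing_seqP => n; rewrite seriesSr lerDl.
by exists (K * `|u|) => _ [N _ <-]; exact: partial_le.
Qed.

Lemma ell1_comb_linear : linear (ell1_comb c).
Proof.
move=> a u v; have cu := @ell1_comb_cvg u; have cv := @ell1_comb_cvg v.
rewrite {1}/ell1_comb.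
have -> : series (fun n => (a *: u + v) n *: c n) =
    a *: series (fun n => u n *: c n) + series (fun n => v n *: c n).
  apply/funext => N; rewrite !fctE /series /= scaler_sumr -big_split.
  by apply: eq_bigr => i _ /=; rewrite scalerDl scalerA.
by rewrite limD// ?limZl_tmp//; exact: cvgZl_tmp.
Qed.

Lemma ell1_comb_le (u : ell1 R) : `|ell1_comb c u| <= K * `|u|.
Proof.
have /cvg_norm cvu := @ell1_comb_cvg u.
rewrite -(cvg_lim _ cvu)//; apply: limr_le.
  by apply/cvg_ex; eexists; exact: cvu.
apply: nearW => N; apply: le_trans (partial_le u N).
exact: ler_norm_sum.
Qed.

End Bounded.

Lemma ell1_comb_unit (W : completeNormedModType R) (c : nat -> W) n :
  ell1_comb c (ell1_unit n) = c n.
Proof.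
rewrite /ell1_comb; apply/cvg_lim => //.
apply: (@cvg_near_cst _ _ (c n)).
near=> N; rewrite /series /= (bigD1_seq n)/= ?iota_uniq//; last first.
  by rewrite mem_index_iota/=; near: N; exists n.+1.
rewrite eqxx scale1r big1 ?addr0// => i /negbTE ->; exact: scale0r.
Unshelve. all: by end_near. Qed.

Lemma ell1_comb_op (W W' : completeNormedModType R) (c : nat -> W) (K : R)
    (f : {linear W -> W'}) (u : ell1 R) : (forall n, `|c n| <= K) ->
  bounded_operator f -> f (ell1_comb c u) = ell1_comb (f \o c) u.
Proof.
move=> cK [C fC].
have fcont : continuous f.
  apply/linear_bounded_continuous; apply/linear_boundedP.
  exists C; split; first exact: num_real.
  by move=> r /ltW Cr x; apply: (le_trans (fC x)); rewrite ler_wpM2r.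
rewrite /ell1_comb; apply/esym/cvg_lim => //.
have -> : series (fun n => u n *: (f \o c) n) =
    f \o series (fun n => u n *: c n).
  apply/funext => N; rewrite /series /= linear_sum.
  by apply: eq_bigr => i _; rewrite linearZ.
exact: (@continuous_cvg _ _ _ _ _ _ f _ (fcont _) (@ell1_comb_cvg _ _ _ cK u)).
Qed.

End Ell1Comb.

(** * Averages, and the Poisson equation of a terminating walk *)

Section Average.
Variable R : realType.

Definition avg (X : Type) (W : lmodType R) (A : seq X) (h : X -> W) : W :=
  (size A)%:R^-1 *: \sum_(w <- A) h w.

Lemma avg_nil (X : Type) (W : lmodType R) (h : X -> W) : avg [::] h = 0.
Proof. by rewrite /avg big_nil scaler0. Qed.

Lemma eq_in_avg (X : eqType) (W : lmodType R) (A : seq X) (h h' : X -> W) :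
  {in A, h =1 h'} -> avg A h = avg A h'.
Proof. by move=> hh'; rewrite /avg; congr (_ *: _); exact: eq_big_seq. Qed.

Lemma linear_avg (X : Type) (W W' : lmodType R) (f : {linear W -> W'})
  (A : seq X) (h : X -> W) : f (avg A h) = avg A (f \o h).
Proof. by rewrite /avg linearZ linear_sum. Qed.

Lemma avgB (X : Type) (W : lmodType R) (A : seq X) (h h' : X -> W) :
  avg A (fun w => h w - h' w) = avg A h - avg A h'.
Proof. by rewrite /avg -scalerBr sumrB. Qed.

Lemma avgZ (X : Type) (W : lmodType R) (A : seq X) (a : R) (h : X -> W) :
  avg A (fun w => a *: h w) = a *: avg A h.
Proof. by rewrite /avg -scaler_sumr !scalerA mulrC. Qed.

Lemma avg_cst (X : eqType) (W : lmodType R) (A : seq X) (v : W) :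
  A != [::] -> avg A (fun=> v) = v.
Proof.
move=> A0; rewrite /avg big_const_seq count_predT iter_addr_0.
rewrite -[v *+ _]scaler_nat scalerA.
by rewrite mulVf ?scale1r// pnatr_eq0 size_eq0.
Qed.

(** By recursion along the rank.  With real values this inverts the Laplacian of
the walk; with values in [l^1] it produces the Green measures. *)
Lemma poisson_solution (X : eqType) (W : lmodType R) (rk : X -> nat)
    (A : X -> seq X) (c : X -> W) :
  (forall x w, w \in A x -> (rk w < rk x)%N) ->
  exists h : X -> W, forall x, h x = c x + avg (A x) h.
Proof.
move=> rkA; pose step (h : X -> W) x := c x + avg (A x) h.
have stable n m x : (rk x < n)%N -> (rk x < m)%N ->
    iter n step (fun=> 0) x = iter m step (fun=> 0) x.
  elim: n m x => // n IH [//|m] x xn xm /=; rewrite /step.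
  congr (_ + _); apply: eq_in_avg => w /rkA wx; apply: IH; lia.
(* Below rank [n], iterating the defining equation [n] times is enough. *)
exists (fun x => iter (rk x).+1 step (fun=> 0) x) => x; rewrite iterS {1}/step.
congr (_ + _); apply: eq_in_avg => w /rkA wx.
by rewrite (stable (rk x) (rk w).+1).
Qed.

Section Norm.
Variables (X : eqType) (W : normedModType R).
Implicit Types (A : seq X) (h : X -> W).

(** One value smaller than the common bound [K] lowers the bound on the average
by the weight of that value, which is at least [1 / M]. *)
Lemma norm_avg_deficit A h w0 (K b : R) (M : nat) :
  w0 \in A -> (size A <= M)%N -> b <= K ->
  (forall w, w \in A -> `|h w| <= K) -> `|h w0| <= b ->
  `|avg A h| <= K - (K - b) / M%:R.
Proof.
move=> w0A AM bK hK hb.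
have A0 : (0 < size A)%N by case: (A) w0A.
have sR : 0 < (size A)%:R :> R by rewrite ltr0n.
rewrite /avg normrZ ger0_norm ?invr_ge0 ?ler0n//.
apply: (@le_trans _ _ (K - (K - b) / (size A)%:R)); last first.
  rewrite lerD2l lerN2 ler_wpM2l ?subr_ge0// lef_pV2 ?posrE ?ltr0n ?ler_nat//.
  by lia.
rewrite mulrC ler_pdivrMr// mulrBl divfK ?gt_eqF//.
apply: le_trans (ler_norm_sum _ _ _) _.
rewrite (big_rem w0)//=.
apply: (@le_trans _ _ (b + (size (rem w0 A))%:R * K)).
  rewrite lerD// mulr_natl -[leRHS]iter_addr_0 -count_predT -big_const_seq.
  by rewrite big_seq [leRHS]big_seq; apply: ler_sum => w /mem_rem/hK.
rewrite size_rem// -[X in _ <= K * X%:R - _](prednK A0) -natr1; lra.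
Qed.

Lemma norm_avg_le A h K : 0 <= K -> (forall w, w \in A -> `|h w| <= K) ->
  `|avg A h| <= K.
Proof.
case: A => [|w0 A] K0 hK; first by rewrite avg_nil normr0.
have w0A := mem_head w0 A.
have := norm_avg_deficit w0A (leqnn _) (lexx K) hK (hK _ w0A).
by rewrite subrr mul0r subr0.
Qed.

Lemma norm_avgB_le A A' h K : 0 <= K -> A != [::] -> A' != [::] ->
  (forall w w', w \in A -> w' \in A' -> `|h w - h w'| <= K) ->
  `|avg A h - avg A' h| <= K.
Proof.
move=> K0 A0 A'0 hK.
rewrite -(avg_cst (avg A' h) A0) -avgB; apply: norm_avg_le => // w wA.
rewrite -(avg_cst (h w) A'0) -avgB; apply: norm_avg_le => // w' w'A.
exact: hK.
Qed.

(** The coupling estimate: the difference of the averages is the average of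
[h w - h w'] over all pairs, and the pair [(w0, w0)], of weight at least
[1 / M ^ 2], contributes nothing. *)
Lemma norm_avgB_contract A A' h w0 K (M : nat) : 0 <= K ->
  w0 \in A -> w0 \in A' -> (size A <= M)%N -> (size A' <= M)%N ->
  (forall w w', w \in A -> w' \in A' -> `|h w - h w'| <= K) ->
  `|avg A h - avg A' h| <= K - K / M%:R ^+ 2.
Proof.
move=> K0 wA wA' AM A'M hK.
have nz (B : seq X) : w0 \in B -> B != [::] by case: B.
rewrite -(avg_cst (avg A' h) (nz _ wA)) -avgB.
have -> : K / M%:R ^+ 2 = (K - (K - K / M%:R)) / M%:R.
  by rewrite subKr expr2 invfM mulrA.
apply: (norm_avg_deficit wA AM).
- by rewrite gerBl divr_ge0.
- move=> w wAA; rewrite -(avg_cst (h w) (nz _ wA')) -avgB.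
  by apply: norm_avg_le => // w' w'A; exact: hK.
- rewrite -(avg_cst (h w0) (nz _ wA')) -avgB -{2}(subr0 K).
  apply: (norm_avg_deficit wA' A'M) => //; last by rewrite subrr normr0.
  by move=> w' w'A; exact: hK.
Qed.

End Norm.
End Average.

(** * The descending walk of a hyperbolic group *)

(** A walk on [X] absorbed at [e], whose step from [x] is uniform on the list
[A x].  The last field is the dual form of the Green measures being Lipschitz
in [l^1]: potentials of bounded functions are Lipschitz. *)
Record potential_kernel (R : realType) (X : eqType) (d : X -> X -> nat) (e : X)
    (A : X -> seq X) : Prop := PotentialKernel {
  kernel_base : A e = [::] ;
  kernel_nonempty : forall x, x != e -> A x != [::] ;
  kernel_rank : exists rk : X -> nat,
    forall x w, w \in A x -> (rk w < rk x)%N ;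
  kernel_step : exists B : nat, forall x w, w \in A x -> (d x w <= B)%N ;
  kernel_potential : exists2 C : R, 0 < C & forall f : X -> R^o,
    (forall x, `|f x - avg (A x) f| <= 1) ->
    forall x y, `|f x - f y| <= C * (d x y)%:R }.

Section HyperbolicKernel.
Variables (R : realType) (G : groupType) (S : set G).
Hypothesis genS : generates S.
Variable delta : R.
Hypothesis delta0 : 0 <= delta.
Local Notation len := (word_length S).
Local Notation dist := (word_dist S).

(* The Gromov product based at the identity. *)
Let gp (x y : G) : R := ((len x)%:R + (len y)%:R - (dist x y)%:R) / 2.

Hypothesis hyp4 : forall x y z, Num.min (gp x y) (gp y z) - delta <= gp x z.

Let gpC x y : gp x y = gp y x.
Proof. by rewrite /gp (word_distC genS) [X in X - _]addrC. Qed.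

Let gp_trans (a : R) x y z : a <= gp x y -> a <= gp y z -> a - delta <= gp x z.
Proof.
move=> xy yz; apply: le_trans (hyp4 x y z).
by rewrite lerD2r le_min xy yz.
Qed.

(* With [3 delta <= N], if two points of a sphere are within [6 delta] of each
other, then their Gromov product is at least the radius of the sphere one level
below, so that geodesics to either of them serve both up to [delta]. *)
Variable N : nat.
Hypotheses (N0 : (0 < N)%N) (N3 : 3 * delta <= N%:R).
Variable ball : seq G.
Hypothesis ballP : forall x, (len x <= N + N)%N -> x \in ball.

(* The largest multiple of [N] strictly below the length of [x]. *)
Let lev (x : G) : nat := ((len x).-1 %/ N * N)%N.

Let levE k n : (k * N <= n < k * N + N)%N -> (n %/ N * N = k * N)%N.
Proof.
move=> /andP[kn nk]; rewrite -(subnKC kn) divnMDl// divn_small ?addn0//; lia.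
Qed.

Let lev_bounds x : x != 1%g -> (lev x < len x <= lev x + N)%N.
Proof.
move=> x1; have lx : (0 < len x)%N.
  by rewrite lt0n; apply: contra_neq x1; exact: word_length_eq0.
have := divn_eq (len x).-1 N; have := ltn_pmod (len x).-1 N0.
rewrite -/(lev x); lia.
Qed.

(** For [w] of length [lev x], the last condition says that passing through [w]
lengthens the way from [1] to [x] by at most [2 delta].  The ball only serves to
make the set an explicit list of bounded size. *)
Definition descent (x : G) : seq G :=
  if x == 1%g then [::] else
  [seq w <- [seq (x * b)%g | b <- ball] |
    (len w == lev x) && ((lev x)%:R - delta <= gp w x)].

Let descent_ub x w : w \in descent x ->
  [/\ x != 1%g, len w = lev x & (lev x)%:R - delta <= gp w x].
Proof.
rewrite /descent; case: ifPn => // x1.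
by rewrite mem_filter => /andP[/andP[/eqP ? ?] _].
Qed.

Let descent_step x w : x != 1%g -> len w = lev x ->
  (lev x)%:R - delta <= gp w x -> (dist x w <= N + N)%N.
Proof.
move=> x1 wl wx; have /andP[_ lxN] := lev_bounds x1.
rewrite -(ler_nat R) natrD (word_distC genS).
have : (len x)%:R <= (lev x)%:R + N%:R :> R by rewrite -natrD ler_nat.
move: wx N3 delta0; rewrite /gp wl; lra.
Qed.

Let descent_in x w : x != 1%g -> len w = lev x ->
  (lev x)%:R - delta <= gp w x -> w \in descent x.
Proof.
move=> x1 wl wx; rewrite /descent (negbTE x1) mem_filter wl eqxx wx /=.
rewrite -(mulVKg x w); apply: map_f; apply: ballP.
exact: descent_step.
Qed.

Let geodesic_descent x : x != 1%g ->
  exists w, len w = lev x /\ gp w x = (lev x)%:R.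
Proof.
move=> x1; have /andP[/ltnW lx _] := lev_bounds x1.
case: (word_geodesic genS lx) => w [wl wx]; exists w; split => //.
rewrite /gp wl -wx natrD; lra.
Qed.

Let size_descent x : (size (descent x) <= size ball)%N.
Proof.
rewrite /descent; case: ifP => // _; rewrite size_filter.
by rewrite (leq_trans (count_size _ _))// size_map.
Qed.

(* The bound [6 delta] does not depend on the distance from [x] to [y]: this is
what stops the distance between two walks from growing. *)
Let descent_cross x y w w' : lev x = lev y -> (lev x)%:R <= gp x y ->
  w \in descent x -> w' \in descent y -> (dist w w')%:R <= 6 * delta.
Proof.
move=> xy gxy /descent_ub[_ wl wx] /descent_ub[_ wl' wy].
have wy1 : (lev x)%:R - delta - delta <= gp w y.
  by apply: (gp_trans wx); rewrite (le_trans _ gxy)// gerBl.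
have := gp_trans wy1; rewrite /gp => /(_ w').
rewrite -/(gp y w') -/(gp w w').
have -> : (lev x)%:R - delta - delta <= gp y w'.
  by rewrite gpC (le_trans _ wy)// -xy gerBl.
by move=> /(_ isT); rewrite /gp wl wl' -xy; lra.
Qed.

Section Potential.
Variable f : G -> R^o.
Hypothesis f1 : forall x, `|f x - avg (descent x) f| <= 1.

(* The fixed point of [a |-> 2 + (a - a / M ^ 2)], where [M] is the size of the
ball. *)
Let K : R := 2 * (size ball)%:R ^+ 2.

(* The oscillation of [f] at scale [6 delta] is bounded on all spheres
[k * N] at once: going up one level, it is contracted by [norm_avgB_contract],
and the two values of [f - P f] add at most [2]. *)
Let sphere_osc k z z' : len z = (k * N)%N -> len z' = (k * N)%N ->
  (dist z z')%:R <= 6 * delta -> `|f z - f z'| <= K.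
Proof.
have K0 : 0 <= K by rewrite mulr_ge0// exprn_ge0.
elim: k z z' => [|k IH] z z' zk z'k zz'.
  rewrite (word_length_eq0 genS zk) (word_length_eq0 genS z'k).
  by rewrite subrr normr0.
have neq1 x : len x = (k.+1 * N)%N -> x != 1%g.
  by move=> xk; apply/eqP => x1; move: xk; rewrite x1 word_length1//; lia.
have levk x : len x = (k.+1 * N)%N -> lev x = (k * N)%N.
  by move=> xk; rewrite /lev; apply: levE; lia.
have [w [wl wz]] := geodesic_descent (neq1 _ zk).
have gzz' : (lev z)%:R <= gp z z'.
  rewrite /gp levk// zk z'k mulSn natrD; move: N3; lra.
(* The geodesic point [w] below [z] is also an admissible target from [z']. *)
have wAz : w \in descent z.
  by apply: descent_in => //; [exact: neq1|rewrite wz gerBl].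
have wAz' : w \in descent z'.
  apply: descent_in; rewrite ?(levk z')//; first exact: neq1.
    by rewrite wl levk.
  by rewrite -(levk z)//; apply: gp_trans gzz'; rewrite wz.
have := @norm_avgB_contract _ _ _ _ _ f w K _ K0 wAz wAz' (size_descent z)
  (size_descent z').
have cross v v' : v \in descent z -> v' \in descent z' -> `|f v - f v'| <= K.
  move=> vz v'z'.
  have [_ vl _] := descent_ub vz; have [_ vl' _] := descent_ub v'z'.
  apply: IH; rewrite ?vl ?vl' ?levk//.
  by apply: (descent_cross _ gzz' vz v'z'); rewrite !levk.
move=> /(_ cross).
have -> : K / (size ball)%:R ^+ 2 = 2.
  rewrite /K mulfK// expf_neq0// pnatr_eq0 -lt0n.
  by apply: leq_trans (size_descent z); case: (descent z) wAz.
have := f1 z; have := f1 z'.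
rewrite !ler_norml => /andP[? ?] /andP[? ?] /andP[? ?]; apply/andP; split; lra.
Qed.

Let edge_bound x y : (dist x y <= 1)%N -> (len x <= len y)%N ->
  `|f x - f y| <= K + 2.
Proof.
have K0 : 0 <= K by rewrite mulr_ge0// exprn_ge0.
move=> xy lxy.
have lyx : (len y <= len x + 1)%N.
  have := word_lengthM genS x (x^-1 * y)%g; rewrite mulVKg.
  by move/leq_trans; apply; rewrite leq_add2l.
have [y1|y1] := eqVneq y 1%g.
  have -> : x = 1%g.
    by apply: (word_length_eq0 genS); move: lxy; rewrite y1 word_length1//; lia.
  by rewrite y1 subrr normr0 addr_ge0.
have /andP[ly yl] := lev_bounds y1.
have dR : (dist x y)%:R <= 1 :> R by rewrite (ler_nat R _ 1).
have lxyR : (len x)%:R <= (len y)%:R :> R by rewrite ler_nat.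
have [lx|lx] := ltnP (lev y) (len x).
(* Either the two ends jump to the same sphere, or the lower end already lies
on the sphere to which the upper end jumps. *)
- have levxy : lev x = lev y.
    by rewrite /lev; apply: levE; rewrite -/(lev y); lia.
  have x1 : x != 1%g by apply/eqP => x1; move: lx; rewrite x1 word_length1.
  have gxy : (lev x)%:R <= gp x y.
    have : ((lev y) + 1)%:R <= (len x)%:R :> R by rewrite ler_nat addn1.
    by rewrite /gp levxy natrD; lra.
  have nz v : v != 1%g -> descent v != [::].
    move=> v1; have [w [wl wv]] := geodesic_descent v1.
    have : w \in descent v by apply: descent_in => //; rewrite wv gerBl.
    by case: (descent v).
  have : `|avg (descent x) f - avg (descent y) f| <= K.
    apply: norm_avgB_le; rewrite ?nz// => w w' wx w'y.
    have [_ wl _] := descent_ub wx; have [_ wl' _] := descent_ub w'y.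
    apply: (@sphere_osc ((len x).-1 %/ N)) => //; first by rewrite wl' -levxy.
    exact: (descent_cross levxy gxy).
  have := f1 x; have := f1 y.
  rewrite !ler_norml => /andP[? ?] /andP[? ?] /andP[? ?]; apply/andP; split; lra.
- have lxE : len x = lev y by lia.
  have lyE : (len y)%:R = (lev y)%:R + 1 :> R.
    by rewrite natr1; congr (_%:R); lia.
  have gyx : (lev y)%:R - delta <= gp y x.
    by rewrite gpC /gp lxE lyE; move: delta0; lra.
  have [w0 [wl0 wy0]] := geodesic_descent y1.
  have nz : descent y != [::].
    have : w0 \in descent y by apply: descent_in => //; rewrite wy0 gerBl.
    by case: (descent y).
  have : `|avg (descent y) (fun w => f w - f x)| <= K.
    apply: norm_avg_le => // w wy; have [_ wl gw] := descent_ub wy.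
    apply: (@sphere_osc ((len y).-1 %/ N)) => //.
    by have := gp_trans gw gyx; rewrite /gp wl lxE; move: delta0; lra.
  rewrite avgB avg_cst//; have := f1 y.
  rewrite !ler_norml => /andP[? ?] /andP[? ?]; apply/andP; split; lra.
Qed.

Lemma potential_lipschitz x y : `|f x - f y| <= (K + 2) * (dist x y)%:R.
Proof.
apply: (lipschitz_edges genS) => {x y} x s Ss.
have dxs : (dist x (x * s) <= 1)%N.
  by rewrite /word_dist mulKg; exact: word_length_letter.
have [|/ltnW] := leqP (len (x * s)%g) (len x) => lxs.
  by apply: edge_bound => //; rewrite (word_distC genS).
by rewrite distrC; exact: edge_bound.
Qed.

End Potential.

Lemma descent_kernel : potential_kernel R dist 1%g descent.
Proof.
split.
- by rewrite /descent eqxx.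
- move=> x x1; have [w [wl wx]] := geodesic_descent x1.
  have : w \in descent x by apply: descent_in => //; rewrite wx gerBl.
  by case: (descent x).
- exists len => x w /descent_ub[x1 -> _].
  by have /andP[] := lev_bounds x1.
- by exists (N + N)%N => x w /descent_ub[]; exact: descent_step.
- exists (2 * (size ball)%:R ^+ 2 + 2) => [|f]; last exact: potential_lipschitz.
  by rewrite ltr_wpDl// mulr_ge0// exprn_ge0.
Qed.

End HyperbolicKernel.

Lemma hyperbolic_potential_kernel (R : realType) (G : groupType) (S : set G) :
  finite_set S -> generates S ->
  gromov_hyperbolic (fun g h => (word_dist S g h)%:R : R) ->
  exists A, potential_kernel R (word_dist S) 1%g A.
Proof.
move=> finS genS [delta d0 hyp].
pose N := (Num.bound (3 * delta)).+1.
have N3 : 3 * delta <= N%:R.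
  apply/ltW/(lt_le_trans (archi_boundP _)); first by rewrite mulr_ge0.
  by rewrite ler_nat.
have [ball ballP] := word_length_ball genS (N + N) finS.
exists (descent S delta N ball); apply: descent_kernel => //.
move=> x y z; have := hyp x y z 1%g; rewrite /gromov_product.
by rewrite !word_dist1// !word_dist1l.
Qed.

Lemma potential_kernel_change (R : realType) (G : groupType) (S T : set G) A :
  finite_set S -> finite_set T -> generates S -> generates T ->
  potential_kernel R (word_dist S) 1%g A ->
  potential_kernel R (word_dist T) 1%g A.
Proof.
move=> finS finT genS genT [A1 Ax rk [B AB] [C C0 AC]].
have [K KP] := word_length_compare genS genT finT.
have [L LP] := word_length_compare genT genS finS.
split => //.
  exists (L * B)%N => x w /AB xw; apply: leq_trans (LP _ _) _.
  by rewrite leq_mul2l xw orbT.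
(* [K.+1] instead of [K] keeps the constant positive. *)
exists (C * K.+1%:R) => [|f f1 x y]; first by rewrite mulr_gt0.
rewrite (le_trans (AC f f1 x y))// -mulrA ler_pM2l// -natrM ler_nat.
by rewrite (leq_trans (KP _ _))// leq_mul2r leqnSn orbT.
Qed.

(** * The Lipschitz-free space as a renorming of l^1 *)

Section FreeSpace.
Variables (R : realType) (X : choiceType) (d : X -> X -> nat) (e : X).
Variables (A : X -> seq X) (kerA : potential_kernel R d e A).
Variables (pt : nat -> X) (idx : X -> nat).
Hypotheses (ptK : cancel pt idx) (pt_neq : forall n, pt n != e).
Hypothesis idxK : forall x, x != e -> pt (idx x) = x.

Implicit Types (f : X -> R^o) (u v : ell1 R) (T : X -> X).

Definition nonexpanding f := forall x y, `|f x - f y| <= (d x y)%:R.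

Definition laplacian f n : R^o := f (pt n) - avg (A (pt n)) f.

(** The value at [f] of the element of the free space with coordinates [u]: the
basis vector [n] stands for the Dirac mass at [pt n] minus its image under one
step of the walk. *)
Definition pairing f : ell1 R -> R^o := ell1_comb (laplacian f).

Lemma laplacian_bounded :
  exists2 B : R, 0 < B & forall f n, nonexpanding f -> `|laplacian f n| <= B.
Proof.
have [B AB] := kernel_step kerA; exists B.+1%:R => // f n f1.
rewrite /laplacian -(avg_cst (f (pt n)) (kernel_nonempty kerA (pt_neq n))).
rewrite -avgB; apply: norm_avg_le => // w /AB wB.
by rewrite (le_trans (f1 _ _))// ler_nat (leq_trans wB).
Qed.

Lemma pairing_linear f : nonexpanding f -> linear (pairing f).
Proof.
move=> f1; have [B _ fB] := laplacian_bounded.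
by apply: (@ell1_comb_linear _ _ (laplacian f) B) => n; exact: fB.
Qed.

Lemma pairing_le : exists2 B : R, 0 < B &
  forall f u, nonexpanding f -> `|pairing f u| <= B * `|u|.
Proof.
have [B B0 fB] := laplacian_bounded; exists B => // f u f1.
by apply: ell1_comb_le => n; exact: fB.
Qed.

(** The function [f] is the potential of the signs of [u], scaled to be
1-Lipschitz; so the pairings with 1-Lipschitz functions control the [l^1]
norm. *)
Lemma pairing_attained : exists2 C : R, 0 < C &
  forall u, exists2 f, nonexpanding f & `|u| = C * pairing f u.
Proof.
have [C C0 AC] := kernel_potential kerA; exists C => // u.
have [rk rkA] := kernel_rank kerA.
pose s (x : X) : R^o := Num.sg (u (idx x)).
have [f fE] := poisson_solution s rkA.
have fC : forall x y, `|f x - f y| <= C * (d x y)%:R.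
  apply: AC => x; rewrite [f x]fE addrK /s normr_sg.
  by rewrite -[leRHS]/(1%:R) ler_nat leq_b1.
exists (fun x => C^-1 *: f x).
  move=> x y; rewrite -scalerBr normrZ gtr0_norm ?invr_gt0//.
  by rewrite ler_pdivrMl.
rewrite /pairing /ell1_comb ell1_normE.
have -> : series (fun n => u n *: laplacian (fun x => C^-1 *: f x) n) =
   C^-1 *: (series (fun n => `|u n|) : nat -> R^o).
  apply/funext => N; rewrite !fctE /series /= scaler_sumr.
  apply: eq_bigr => n _; rewrite /laplacian avgZ -scalerBr {1}fE addrK /s ptK.
  by rewrite normrEsg [_ * u n]mulrC; exact: mulrCA.
have cu : cvgn (series (fun n => `|u n|) : nat -> R^o).
  by have := ell1_summable u; rewrite unfold_in => /asboolP.
by rewrite (limZl_tmp C^-1 cu) mulrA mulfV ?gt_eqF// mul1r.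
Qed.

Lemma pairing_inj u v :
  (forall f, nonexpanding f -> pairing f u = pairing f v) -> u = v.
Proof.
move=> uv; have [C _ /(_ (u - v))[f f1 fE]] := pairing_attained.
apply/eqP; rewrite -subr_eq0 -normr_le0 fE.
pose L := linear_map (pairing_linear f1).
by rewrite -[pairing f _]/(L _) linearB /= /L /= uv// subrr mulr0.
Qed.

Lemma free_point_exists : exists free_point : X -> ell1 R, forall x,
  free_point x =
    (if x == e then 0 else ell1_unit R (idx x)) + avg (A x) free_point.
Proof. by have [rk rkA] := kernel_rank kerA; exact: poisson_solution rkA. Qed.

(** The Green measure of the walk started at [x], which is the vector of [l^1]
that represents the Dirac mass at [x]. *)
Definition free_point : X -> ell1 R := sval (cid free_point_exists).

Lemma free_pointE x :
  free_point x =
    (if x == e then 0 else ell1_unit R (idx x)) + avg (A x) free_point.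
Proof. by rewrite /free_point; case: cid. Qed.

(** Telescoping along the walk, which stops at [e]. *)
Lemma pairing_free_point f x :
  nonexpanding f -> pairing f (free_point x) = f x - f e.
Proof.
move=> f1; pose L := linear_map (pairing_linear f1).
have [rk rkA] := kernel_rank kerA.
elim: {x}(rk x).+1 {-2}x (ltnSn (rk x)) => // n IH x xn.
rewrite -[pairing f _]/(L _) free_pointE linearD.
have [->|xe] := eqVneq x e.
  by rewrite (kernel_base kerA) avg_nil !linear0 addr0 subrr.
rewrite linear_avg (_ : avg _ _ = avg (A x) (fun w => f w - f e)); last first.
  apply: eq_in_avg => w /rkA wx; apply: IH; exact: leq_trans wx _.
rewrite avgB avg_cst ?(kernel_nonempty kerA)//=.
by rewrite /pairing ell1_comb_unit /laplacian idxK// addrA subrK.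
Qed.

Lemma pairing_free_pointB f x y : nonexpanding f ->
  pairing f (free_point x - free_point y) = f x - f y.
Proof.
move=> f1; pose L := linear_map (pairing_linear f1).
rewrite -[pairing f _]/(L _) linearB /= /L /= !pairing_free_point//.
by rewrite opprB addrA subrK.
Qed.

Lemma free_point_base : free_point e = 0.
Proof. by rewrite free_pointE eqxx (kernel_base kerA) avg_nil addr0. Qed.

Lemma free_point_lipschitz : exists2 C : R, 0 < C &
  forall x y, `|free_point x - free_point y| <= C * (d x y)%:R.
Proof.
have [C C0 att] := pairing_attained; exists C => // x y.
have [f f1 ->] := att (free_point x - free_point y).
by rewrite pairing_free_pointB// ler_pM2l// (le_trans (ler_norm _) (f1 _ _)).
Qed.

Definition free_norm u : R := sup [set `|pairing f u| | f in nonexpanding].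

Lemma free_norm_ub f u : nonexpanding f -> `|pairing f u| <= free_norm u.
Proof.
move=> f1; have [B _ fB] := pairing_le.
apply: ub_le_sup; last by exists f.
by exists (B * `|u|) => _ [g g1 <-]; exact: fB.
Qed.

Lemma free_norm_le u M :
  (forall f, nonexpanding f -> `|pairing f u| <= M) -> free_norm u <= M.
Proof.
move=> uM; apply: ge_sup => [|_ [f f1 <-]]; last exact: uM.
by exists `|pairing (fun=> 0) u|, (fun=> 0) => // x y; rewrite subrr normr0.
Qed.

Lemma free_normD u v : free_norm (u + v) <= free_norm u + free_norm v.
Proof.
apply: free_norm_le => f f1; pose L := linear_map (pairing_linear f1).
rewrite -[pairing f _]/(L _) linearD /= (le_trans (ler_normD _ _))//.
by rewrite lerD// free_norm_ub.
Qed.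

Lemma free_normZ a u : free_norm (a *: u) = `|a| * free_norm u.
Proof.
have le b v : free_norm (b *: v) <= `|b| * free_norm v.
  apply: free_norm_le => f f1; pose L := linear_map (pairing_linear f1).
  by rewrite -[pairing f _]/(L _) linearZ normrZ ler_wpM2l// free_norm_ub.
apply/eqP; rewrite eq_le le /=.
have [->|a0] := eqVneq a 0.
  rewrite normr0 mul0r (le_trans (normr_ge0 (pairing (fun=> 0) (0 *: u))))//.
  by apply: free_norm_ub => x y; rewrite subrr normr0.
rewrite -ler_pdivlMl ?normr_gt0// -normfV.
by rewrite -{1}(scale1r u) -(mulVf a0) -scalerA le.
Qed.

Lemma free_norm_bound : exists2 K : R, 0 < K &
  forall u, free_norm u <= K * `|u|.
Proof.
have [B B0 fB] := pairing_le; exists B => // u.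
by apply: free_norm_le => f; exact: fB.
Qed.

Lemma free_norm_cobound : exists2 C : R, 0 < C &
  forall u, `|u| <= C * free_norm u.
Proof.
have [C C0 att] := pairing_attained; exists C => // u.
have [f f1 ->] := att u; rewrite ler_pM2l//.
exact: le_trans (ler_norm _) (free_norm_ub _ f1).
Qed.

Definition free_eqnorm : equivalent_norm (ell1 R) :=
  EquivalentNorm free_normD free_normZ free_norm_bound free_norm_cobound.

(** The lower bound is attained at the distance function to [y]. *)
Lemma free_norm_dist x y : (forall x y, d x y = d y x) ->
  (forall x, d x x = 0%N) ->
  (forall x y z, d x z <= d x y + d y z)%N ->
  free_norm (free_point x - free_point y) = (d x y)%:R.
Proof.
move=> dC dxx dD.
apply/eqP; rewrite eq_le; apply/andP; split.
  by apply: free_norm_le => f f1; rewrite pairing_free_pointB// f1.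
pose f (z : X) : R^o := (d z y)%:R.
have f1 : nonexpanding f.
  move=> z t; rewrite /f ler_norml; apply/andP; split.
    by rewrite lerNl opprB lerBlDr -natrD ler_nat [d z t]dC dD.
  by rewrite lerBlDr -natrD ler_nat dD.
have := free_norm_ub (free_point x - free_point y) f1.
by rewrite pairing_free_pointB// /f dxx subr0 normr_nat.
Qed.

(** The affine map that [T] induces on the free space has a linear part [push T],
which sends the Dirac mass at [x], taken modulo the one at [e], to the difference
of the Dirac masses at [T x] and [T e].  This is its value on the basis vector
[n]; the Dirac mass at [T e] cancels. *)
Definition push_col T n : ell1 R :=
  free_point (T (pt n)) - avg (A (pt n)) (free_point \o T).

Definition push T : ell1 R -> ell1 R := ell1_comb (push_col T).

Variable T : X -> X.
Hypothesis T1 : forall x y, (d (T x) (T y) <= d x y)%N.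

Lemma nonexpanding_comp f : nonexpanding f -> nonexpanding (f \o T).
Proof. by move=> f1 x y; rewrite (le_trans (f1 _ _))// ler_nat. Qed.

(** A column is an average of differences of Green measures at points a bounded
distance apart. *)
Lemma push_col_bounded : exists K : R, forall n, `|push_col T n| <= K.
Proof.
have [B AB] := kernel_step kerA; have [C C0 pC] := free_point_lipschitz.
exists (C * B%:R) => n; rewrite /push_col.
rewrite -(avg_cst (free_point (T (pt n))) (kernel_nonempty kerA (pt_neq n))).
rewrite -avgB.
apply: norm_avg_le => [|w /AB wB]; first by rewrite mulr_ge0// ltW.
by rewrite (le_trans (pC _ _))// ler_pM2l// ler_nat (leq_trans (T1 _ _)).
Qed.

Lemma push_linear : linear (push T).
Proof. by have [K TK] := push_col_bounded; exact: ell1_comb_linear TK. Qed.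

(** [push T] is dual to composition with [T]; all algebraic properties of the
action follow from this and [pairing_inj]. *)
Lemma pairing_push f u : nonexpanding f ->
  pairing f (push T u) = pairing (f \o T) u.
Proof.
move=> f1; have [K TK] := push_col_bounded.
pose L := linear_map (pairing_linear f1).
have Lb : bounded_operator L.
  by have [B _ fB] := pairing_le; exists B => v; exact: fB.
rewrite -[pairing f _]/(L _) /push (ell1_comb_op u TK Lb) /pairing.
congr (ell1_comb _ u); apply/funext => n; rewrite -[LHS]/(L (push_col T n)).
rewrite /push_col linearB linear_avg /L /= pairing_free_point//.
rewrite (_ : avg _ _ = avg (A (pt n)) (fun w => f (T w) - f e)); last first.
  by apply: eq_in_avg => w _ /=; rewrite pairing_free_point.
rewrite avgB avg_cst ?(kernel_nonempty kerA)// /laplacian /=.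
by rewrite opprB addrA subrK.
Qed.

Lemma free_norm_push u : free_norm (push T u) <= free_norm u.
Proof.
apply: free_norm_le => f f1; rewrite pairing_push//.
exact/free_norm_ub/nonexpanding_comp.
Qed.

End FreeSpace.

(** * The affine action *)

Lemma enumerate_group (G : groupType) (S : set G) :
  infinite_set [set: G] -> finite_set S -> generates S ->
  exists (pt : nat -> G) (idx : G -> nat), [/\ cancel pt idx,
    forall n, pt n != 1%g & forall x, x != 1%g -> pt (idx x) = x].
Proof.
move=> infG finS genS; pose D := [set x : G | x != 1%g].
have cD : countable D.
  apply: (@sub_countable _ _ _
    (\bigcup_(n in [set: nat]) [set x | (word_length S x <= n)%N])).
    by apply: subset_card_le => x _; exists (word_length S x) => /=.
  apply: bigcup_countable => // n _; apply: finite_set_countable.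
  have [b bP] := word_length_ball genS n finS.
  by apply: sub_finite_set (finite_seq b) => x /bP.
have infD : infinite_set D.
  have -> : D = [set: G] `\` [set 1%g].
    by apply/seteqP; split=> x /=; [move=> /eqP|move=> [_] /eqP].
  by apply: infinite_setD => //; exact: finite_set1.
have /card_set_bijP[idx [_ idx_inj idx_surj]] := eq_card_nat cD infD.
have /choice[pt ptP] n : exists x, x != 1%g /\ idx x = n.
  by have [x xD xn] := idx_surj n I; exists x.
exists pt, idx; split => [n|n|x x1]; try by case: (ptP n).
have [p1 p2] := ptP (idx x).
by apply: (idx_inj _ _ _ _ p2); rewrite inE.
Qed.

(** Left translations act on the free space of the [S]-word metric: with [p g]
the vector of the Dirac mass at [g] and [pi g] the pushforward, [g] acts by
[u |-> pi g u + p g]. *)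
Lemma hyperbolic_free_action (R : realType) (G : groupType) (S : set G) :
  infinite_set [set: G] -> hyperbolic_group R G ->
  finite_set S -> generates S ->
  exists (V : completeNormedModType R) (alpha : G -> V -> V),
    [/\ isomorphic_banach V (ell1 R),
        affine_action alpha,
        isometric_action alpha &
        forall g h : G, `|alpha g 0 - alpha h 0| = (word_dist S g h)%:R].
Proof.
move=> infG [S0 [finS0 genS0 hyp]] finS genS.
have [A kerA0] := hyperbolic_potential_kernel finS0 genS0 hyp.
have kerA := potential_kernel_change finS0 finS genS0 genS kerA0.
have [pt [idx [ptK pt_neq idxK]]] := enumerate_group infG finS genS.
pose N := free_eqnorm kerA ptK pt_neq.
pose V : completeNormedModType R := renormed N.
pose p := free_point kerA idx.
pose P g : ell1 R -> ell1 R := push kerA pt idx (fun x => (g * x)%g).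
have T1 g x y : (word_dist S (g * x)%g (g * y)%g <= word_dist S x y)%N.
  by rewrite word_dist_mull.
have Plin g : linear (P g) := push_linear kerA ptK pt_neq idxK (T1 g).
pose pi g : {linear V -> V} := linear_map (Plin g : linear (P g : V -> V)).
have pairP g f u : nonexpanding (word_dist S) f ->
    pairing A pt f (pi g u) = pairing A pt (f \o (fun x => (g * x)%g)) u.
  by move=> f1; exact: pairing_push.
have compN g f : nonexpanding (word_dist S) f ->
    nonexpanding (word_dist S) (f \o (fun x => (g * x)%g)).
  exact: nonexpanding_comp.
have pairpt f x : nonexpanding (word_dist S) f ->
    pairing A pt f (p x) = f x - f 1%g.
  by move=> f1; exact: pairing_free_point.
have piK g h u : pi g (pi h u) = pi (g * h)%g u.
  apply: (pairing_inj kerA ptK pt_neq) => f f1.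
  rewrite !pairP//; last exact: compN.
  by congr (pairing _ _ _ _); apply/funext => x /=; rewrite mulgA.
have pi1 u : pi 1%g u = u.
  apply: (pairing_inj kerA ptK pt_neq) => f f1; rewrite pairP//.
  by congr (pairing _ _ _ _); apply/funext => x /=; rewrite mul1g.
have pi_le g (u : V) : `|pi g u| <= `|u|.
  exact: (free_norm_push kerA ptK pt_neq idxK (T1 g)).
have pi_norm g (u : V) : `|pi g u| = `|u|.
  by apply/eqP; rewrite eq_le pi_le -{1}(pi1 u) -(mulVg g) -piK pi_le.
have pi_inv g : bounded_invertible (pi g).
  split; first by exists 1 => v; rewrite mul1r.
  exists (pi g^-1%g); split; first by exists 1 => v; rewrite mul1r.
  - by move=> u; rewrite piK mulVg pi1.
  - by move=> u; rewrite piK mulgV pi1.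
exists V, (fun g u => pi g u + (p g : V)); split.
- exact: renormed_isomorphic.
- split; last by exists pi, p => g; split.
  split=> [u|g h u].
    by rewrite pi1 [p 1%g](free_point_base _ _) addr0.
  rewrite linearD piK -addrA; congr (_ + _).
  apply: (pairing_inj kerA ptK pt_neq) => f f1.
  rewrite pairpt//; pose L := linear_map (pairing_linear kerA pt_neq f1).
  rewrite -[RHS]/(L (_ + _)) linearD.
  rewrite -[L (pi g (p h))]/(pairing A pt f _) -[L (p g)]/(pairing A pt f _).
  rewrite pairP// !pairpt//; last exact: compN.
  by rewrite /= mulg1 addrA subrK.
- by move=> g u v; rewrite opprD addrACA subrr addr0 -linearB pi_norm.
- move=> g h; rewrite !linear0 !add0r.
  apply: (free_norm_dist kerA pt_neq idxK).
  + exact: word_distC.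
  + exact: word_distxx.
  + exact: word_dist_triangle.
Qed.

(** If [g] moves [v] into a ball of radius [r], it moves [0] by at most
[r + |v|] plus a constant, which bounds the word length of [g]. *)
Lemma proper_of_isometric_orbit (R : realType) (G : groupType) (S : set G)
    (V : completeNormedModType R) (alpha : G -> V -> V) :
  finite_set S -> generates S -> isometric_action alpha ->
  (forall g h, `|alpha g 0 - alpha h 0| = (word_dist S g h)%:R) ->
  proper_action alpha.
Proof.
move=> finS genS iso orb v r.
pose M := r + `|v| + `|alpha 1%g 0|.
have [b bP] := word_length_ball genS (Num.bound `|M|) finS.
apply: sub_finite_set (finite_seq b) => g /= gr; apply: bP.
rewrite -word_dist1// -(ler_nat R) -orb.
apply: le_trans (ltW (archi_boundP (normr_ge0 M))).
apply: le_trans (ler_norm M); rewrite /M.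
rewrite (le_trans (ler_normB _ _))// lerD2r.
rewrite -[alpha g 0](subrK (alpha g v)) (le_trans (ler_normD _ _))// addrC.
by rewrite lerD// iso sub0r normrN.
Qed.

(** Conjugating an isometric action by an isomorphism [f] costs the factor
[|f| |f^-1|] in the Lipschitz constants. *)
Lemma transport_action (R : realType) (G : groupType)
    (V W : completeNormedModType R) (alpha : G -> V -> V) :
  isomorphic_banach V W -> affine_action alpha -> isometric_action alpha ->
  proper_action alpha ->
  exists beta : G -> W -> W,
    [/\ affine_action beta, proper_action beta & uniformly_lipschitz beta].
Proof.
move=> [f [[C fC] [f' [[C' fC'] fK f'K]]]] [[a1 aM] [pi [b pib]]] iso prop.
exists (fun g w => f (alpha g (f' w))); split.
- split.
    by split=> [w|g h w]; rewrite ?a1 ?f'K// aM fK.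
  exists (fun g => f \o pi g \o f'), (fun g => f (b g)) => g.
  have [[[K piK] [q [[K' qK'] piq qpi]]] aE] := pib g; split; last first.
    by move=> w; rewrite aE linearD.
  split.
    exists (`|C| * (`|K| * `|C'|)) => w /=.
    rewrite (le_trans (fC _))// -!mulrA (le_trans (ler_wpM2r _ (ler_norm C)))//.
    rewrite ler_wpM2l// (le_trans (piK _))//.
    rewrite (le_trans (ler_wpM2r _ (ler_norm K)))//.
    by rewrite ler_wpM2l// (le_trans (fC' _))// ler_wpM2r// ler_norm.
  exists (f \o q \o f'); split => [|w|w] /=.
  + exists (`|C| * (`|K'| * `|C'|)) => w /=.
    rewrite (le_trans (fC _))// -!mulrA (le_trans (ler_wpM2r _ (ler_norm C)))//.
    rewrite ler_wpM2l// (le_trans (qK' _))//.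
    rewrite (le_trans (ler_wpM2r _ (ler_norm K')))//.
    by rewrite ler_wpM2l// (le_trans (fC' _))// ler_wpM2r// ler_norm.
  + by rewrite fK piq f'K.
  + by rewrite fK qpi f'K.
- move=> w r; apply: sub_finite_set (prop (f' w) (`|C'| * r)) => g /= gr.
  rewrite -[alpha g _]fK (le_trans (fC' _))//.
  by rewrite (le_trans (ler_wpM2r _ (ler_norm C')))// ler_wpM2l.
- exists (`|C| * `|C'|) => g [w w'] _ /=.
  rewrite -linearB (le_trans (fC _))// -mulrA.
  rewrite (le_trans (ler_wpM2r _ (ler_norm C)))// ler_wpM2l// iso -linearB.
  by rewrite (le_trans (fC' _))// ler_wpM2r// ler_norm.
Qed.

Lemma trivial_action_finite (R : realType) (G : groupType)
    (V : completeNormedModType R) : finite_set [set: G] ->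
  exists alpha : G -> V -> V,
    [/\ affine_action alpha, proper_action alpha & uniformly_lipschitz alpha].
Proof.
move=> finG; exists (fun _ v => v); split.
- split; first by [].
  exists (fun=> idfun), (fun=> 0) => g; split; last by move=> v; rewrite addr0.
  split; first by exists 1 => v; rewrite mul1r.
  by exists idfun; split => //; exists 1 => v; rewrite mul1r.
- by move=> v r; exact: sub_finite_set finG.
- by exists 1 => g [v w] _ /=; rewrite mul1r.
Qed.

Theorem theorem5 (R : realType) :
  (forall (G : groupType) (S : set G),
     infinite_set [set: G] -> hyperbolic_group R G ->
     finite_set S -> generates S ->
     exists (V : completeNormedModType R) (alpha : G -> V -> V),
       [/\ isomorphic_banach V (ell1 R),
           affine_action alpha,
           isometric_action alpha &
           forall g h : G,
             `|alpha g 0 - alpha h 0| = (word_dist S g h)%:R]) /\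
  (forall G : groupType, hyperbolic_group R G ->
     exists alpha : G -> ell1 R -> ell1 R,
       [/\ affine_action alpha,
           proper_action alpha &
           uniformly_lipschitz alpha]).
Proof.
split=> [G S|G hypG]; first exact: hyperbolic_free_action.
have [finG|infG] := pselect (finite_set [set: G]).
  exact: trivial_action_finite.
have [S [finS genS _]] := hypG.
have [V [alpha [isoV aff iso orb]]] :=
  hyperbolic_free_action infG hypG finS genS.
apply: (transport_action isoV aff iso).
exact: proper_of_isometric_orbit finS genS iso orb.
Qed.
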